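(* Let $T_d$ be the $d$-regular tree with root $o$, let $\mathcal E$ be an invariant edge percolation on $T_d$, and let $\mathcal E(o)$ be the connected component (cluster) of $o$ in $\mathcal E$. Let $(X_n)_{n\in\mathbb N}$ be the lazy random walk on $T_d$ starting at $o$ (independent of $\mathcal E$). Then for almost every realization of $\mathcal E$ the limit $$\rho_{\mathcal E}:=\lim_{n\to\infty}\mathbb P[X_n\in\mathcal E(o)]^{1/n}$$ exists, where $\mathbb P$ is the probability over the random walk with $\mathcal E$ fixed.
   Context: An invariant edge percolation on $T_d$ is a random subset $\mathcal E$ of the edges of $T_d$ whose law is invariant under the automorphism group of $T_d$. The cluster $\mathcal E(v)$ of a vertex $v$ is the connected component of $v$ in the graph with vertex set $V(T_d)$ and edge set $\mathcal E$. The lazy random walk on $T_d$ stays at its current vertex with probability $1/2$ and moves to each neighbor with probability $1/(2d)$. *)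

(* Defs.v *)
From mathcomp Require Export all_boot all_order all_algebra.
From mathcomp Require Export all_classical all_reals all_analysis.

Set Implicit Arguments.
Unset Strict Implicit.
Unset Printing Implicit Defensive.

Import Order.TTheory GRing.Theory Num.Theory.
Import numFieldNormedType.Exports.

Local Open Scope classical_set_scope.
Local Open Scope ring_scope.

Section Trees.
Variables (V : choiceType) (adj : rel V).

Record is_regular_tree (d : nat) : Prop := IsRegularTree {
  tree_irreflexive : irreflexive adj;
  tree_symmetric : symmetric adj;
  tree_connected : forall x y, exists2 p, path adj x p & last x p = y;
  tree_acyclic : forall c : seq V, (2 < size c)%N -> ~ ucycle adj c;
  tree_regular : forall x, ([set y | adj x y] #= `I_d)%card }.

Definition automorphism (f : V -> V) : Prop :=
  bijective f /\ forall x y, adj (f x) (f y) = adj x y.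

(* Edges are unordered pairs [set x; y], so that a set of edges has type
   [set (set V)]. *)
Definition edges : set (set V) :=
  [set e | exists x y, adj x y /\ e = [set x; y]].

(* Generators of the product sigma-algebra on {0,1}^edges. *)
Definition edge_cylinders : set (set (set (set V))) :=
  [set [set c | c e] | e in edges].

Local Notation configuration := (g_sigma_algebraType edge_cylinders).

Definition move_edges (f : V -> V) (c : configuration) : configuration :=
  [set f @` e | e in c].

(* For c a set of edges, a step from x to itself is impossible, because the
   singleton [set x; x] is not an edge. *)
Definition cluster (c : configuration) (v : V) : set V :=
  [set u | exists2 p, path (fun x y => [set x; y] \in (c : set (set V))) v p
                    & last v p = u].

(* Generators of the product sigma-algebra on the space of trajectories, each
   coordinate carrying the discrete sigma-algebra on V. *)
Definition trajectory_cylinders : set (set (nat -> V)) :=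
  [set C | exists (n : nat) (S : set V), C = [set x | S (x n)]].

Section Probability.
Variables (R : realType) (dsp : measure_display) (T : measurableType dsp).
Variable P : probability T R.

Record invariant_percolation (E : T -> configuration) : Prop :=
  InvariantPercolation {
  percolation_measurable : measurable_fun [set: T] E;
  percolation_edges : forall w, E w `<=` edges;
  percolation_invariant : forall f, automorphism f ->
    forall A : set configuration, measurable A ->
    pushforward P (move_edges f \o E) A = pushforward P E A }.

Definition lazy_step (d : nat) (x y : V) : R :=
  if x == y then 1 / 2 else if adj x y then 1 / (2 * d%:R) else 0.

(* [lazy_walk_step] is the Markov property with the conditional probabilities
   multiplied out: P[X_{n+1} = h_{n+1} | X_0 = h_0, ..., X_n = h_n]
   = lazy_step h_n h_{n+1}. *)
Record lazy_random_walk (d : nat) (o : V) (X : nat -> T -> V) : Prop :=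
  LazyRandomWalk {
  lazy_walk_measurable : forall n (S : set V), measurable (X n @^-1` S);
  lazy_walk_start : P [set w | X 0%N w = o] = 1%E;
  lazy_walk_step : forall (h : nat -> V) (n : nat),
    P [set w | forall i, (i <= n.+1)%N -> X i w = h i] =
    (P [set w | forall i, (i <= n)%N -> X i w = h i]
       * (lazy_step d (h n) (h n.+1))%:E)%E }.

Definition independent_of_walk (E : T -> configuration) (X : nat -> T -> V) :
    Prop :=
  forall (A : set configuration) (B : set (nat -> V)),
    measurable A -> <<s trajectory_cylinders >> B ->
    P [set w | A (E w) /\ B (X ^~ w)] =
    (P [set w | A (E w)] * P [set w | B (X ^~ w)])%E.

(* P[X_n \in c(o)] with the set of edges c held fixed. *)
Definition cluster_hit_probability
    (X : nat -> T -> V) (o : V) (c : configuration) (n : nat) : R :=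
  fine (P [set w | cluster c o (X n w)]).

End Probability.
End Trees.

Notation configuration adj := (g_sigma_algebraType (edge_cylinders adj)).

(* Main.v *)
Require Import Defs.
From mathcomp Require Import finmap zify ring lra measurable_realfun.
Set Implicit Arguments.
Unset Strict Implicit.
Unset Printing Implicit Defensive.
Import Order.TTheory GRing.Theory Num.Theory.
Import numFieldNormedType.Exports.
Local Open Scope classical_set_scope.
Local Open Scope ring_scope.

(** Let p_n(x) be the probability that the lazy walk started at x is at time n
in the cluster of x.  Two facts carry the proof.

Supermultiplicativity along the cluster: p_(n+m)(x) is at least the mean of
p_m(y) over those positions y of the walk from x at time n that lie in the
cluster of x ([return_prob_supermul]).

Mass transport: a regular tree has an automorphism exchanging any two given
vertices ([exists_swap]), so under an invariant percolation the mass expected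
to leave the root along n-step walks equals the mass expected to reach it
([mass_transport]).  Hence the n-step walk conditioned to end in the cluster
is reversible for the percolation biased by p_n.

For r > 0 let B_r be the event that, for some constant C, p_m <= C r^m for
infinitely many m.  It depends only on the cluster, since moving the starting
point inside the cluster changes p_m by a bounded factor and a bounded shift of
time.  The heart of the proof is that, for r < s and n >= 1,

  E[p_n on B_r] <= s^n.

To see this put S_k = k n ln s - ln p_(nk), so that S_0 = 0 and, on B_r, some
S_k is positive.  Supermultiplicativity and the concavity of the logarithm give
a recursive upper bound of S_(k+1) by the mean of S_k over the cluster
([excess_drift]).  This is the situation of the maximal ergodic lemma, and
Garsia's proof of that lemma applies to the running maximum M_N of S_0, ...,
S_N ([maximal_inequality]).  After integration over B_r, mass transport cancels
the two terms that contain M_N, and what remains is the bound above on the part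
of B_r where M_N > 0 ([return_prob_slow_before]); then N tends to infinity.

By Markov's inequality and Borel-Cantelli, almost surely on B_r one has
p_n < t^n for all large n, whenever r < t ([slow_return_eventually_low]).  With
r and t ranging over the rationals, the lower and upper limits of p_n^(1/n)
agree almost surely ([cvg_root]).

The random walk enters only through the laws of its positions ([walk_law]). *)

(** * Automorphisms of a regular tree *)

Section TreeAutomorphisms.
Variables (V : choiceType) (adj : rel V) (d : nat).
Hypothesis tree : is_regular_tree adj d.

Let adjC x y : adj x y = adj y x := tree_symmetric tree x y.

Lemma regular_neighbours : exists nb : V -> seq V,
  forall x, [/\ uniq (nb x), size (nb x) = d
                & forall y, (y \in nb x) = adj x y].
Proof.
exists (fun x => enum_fset (fset_set [set y | adj x y])) => x.
have fin : finite_set [set y | adj x y].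
  by apply/finite_setP; exists d; exact: tree_regular tree x.
split; first exact: fset_uniq.
- exact: card_fset_set (tree_regular tree x).
- move=> y; have := in_fset_set fin y; rewrite /= => ->.
  by apply/idP/idP => [/set_mem|?]; last exact/mem_set.
Qed.

(** The building blocks for a Zorn argument, encoded as relations between
vertices so that the roles of source and target are symmetric.  The last
condition says that the domain is connected, in the form that passes most
easily to unions of chains: a subset closed under adjacency is everything. *)
Record partial_iso (r : set (V * V)) : Prop := PartialIso {
  partial_iso_bij : forall u v, r u -> r v -> (u.1 == v.1) = (u.2 == v.2);
  partial_iso_adj : forall u v, r u -> r v -> adj u.1 v.1 = adj u.2 v.2;
  partial_iso_conn : forall (S : set (V * V)) u, r u -> S u ->
    (forall v w, r v -> r w -> S v -> adj v.1 w.1 -> S w) -> r `<=` S }.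

Definition converse (r : set (V * V)) : set (V * V) := [set u | r (u.2, u.1)].

Lemma partial_iso_converse r : partial_iso r -> partial_iso (converse r).
Proof.
move=> [rbij radj rconn]; split=> [u v ru rv|u v ru rv|S u ru Su Sstep v rv].
- by rewrite (rbij _ _ ru rv).
- by rewrite -(radj _ _ ru rv).
have := rconn (fun w => S (w.2, w.1)) (u.2, u.1) ru;
  rewrite -surjective_pairing.
move=> /(_ Su) /(_ _ (v.2, v.1) rv); rewrite -surjective_pairing; apply.
move=> [a b] [a' b'] rw rw' /= Sw; rewrite (radj _ _ rw rw').
exact: (Sstep (b, a) (b', a')).
Qed.

(** Otherwise the path, made simple, would close up through z to a cycle. *)
Lemma path_attach z a p : path adj a p -> z \notin a :: p -> adj z a ->
  adj z (last a p) -> last a p = a.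
Proof.
move=> /shortenP[q aq Uq sqp] zap za zb; apply/eqP/negPn/negP => qa.
apply: (tree_acyclic tree (c := z :: a :: q));
  first by case: q qa {aq Uq sqp zb} => //=; rewrite eqxx.
apply/andP; split; first by rewrite /= za rcons_path aq adjC.
rewrite cons_uniq Uq andbT; apply: contra zap;
  rewrite !inE => /orP[->//|/sqp ->].
by rewrite orbT.
Qed.

(** A vertex outside the connected domain has at most one neighbour in it, so
that extending a partial isomorphism by one leaf creates no other adjacency. *)
Lemma partial_iso_attach r u v z : partial_iso r -> r u -> r v ->
  (forall w, r w -> w.1 != z) -> adj z u.1 -> adj z v.1 -> v.1 = u.1.
Proof.
move=> [_ _ rconn] ru rv zr zu zv.
have [p pu [lp zp]] : exists2 p, path adj u.1 p & last u.1 p = v.1 /\ z \notin p.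
  apply: (rconn (fun v =>
    exists2 p, path adj u.1 p & last u.1 p = v.1 /\ z \notin p) u) => //.
    by exists [::].
  move=> w w' rw rw' [p pu [lp zp]] ww'; exists (rcons p w'.1).
    by rewrite rcons_path pu lp.
  by rewrite last_rcons mem_rcons inE negb_or zp eq_sym zr.
rewrite -lp; apply: path_attach pu _ zu _; last by rewrite lp.
by rewrite inE negb_or zp eq_sym zr.
Qed.

(** Both u.1 and u.2 have d neighbours.  If all those of u.2 were already
reached, the inverse of r would inject them into the neighbours of u.1 other
than z. *)
Lemma partial_iso_free r u z : partial_iso r -> r u ->
  (forall w, r w -> w.1 != z) -> adj u.1 z ->
  exists2 z', adj u.2 z' & forall w, r w -> w.2 != z'.
Proof.
move=> [rbij radj rconn] ru zr uz; have [nb nbP] := regular_neighbours.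
have [U1 s1 m1] := nbP u.1; have [U2 s2 m2] := nbP u.2.
apply: contrapT => noz.
have full z' : z' \in nb u.2 -> {w | r w & w.2 = z'}.
  rewrite m2 => uz'; apply: cid2; apply: contrapT => h; apply: noz.
  by exists z' => // w rw; apply/eqP => wz'; apply: h; exists w.
pose back z' :=
  if @idP (z' \in nb u.2) is ReflectT h then (s2val (full z' h)).1 else u.1.
have backP z' : z' \in nb u.2 -> r (back z', z').
  rewrite /back; case: {-}_ / idP => // h _.
  by case: (full z' h) => -[a b] /= rw <-.
have : (size (map back (nb u.2)) <= size (rem z (nb u.1)))%N.
  apply: uniq_leq_size.
    rewrite map_inj_in_uniq// => a b /backP ra /backP rb ab.
    by apply/eqP; rewrite -(rbij _ _ ra rb) /= ab.
  move=> _ /mapP[z' z'2 ->]; have rz' := backP _ z'2.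
  rewrite mem_rem_uniq// inE (zr _ rz') m1 /=.
  by rewrite (radj _ _ ru rz') /= -m2.
rewrite size_map s2 size_rem ?m1// s1; case: (d) s1 => [/size0nil e|n _].
  by have := m1 z; rewrite e uz.
by rewrite ltnn.
Qed.

Lemma partial_iso_extend r u z z' : partial_iso r -> r u ->
  (forall w, r w -> w.1 != z) -> (forall w, r w -> w.2 != z') ->
  adj u.1 z -> adj u.2 z' -> partial_iso (r `|` [set (z, z')]).
Proof.
move=> ri ru zr z'r uz uz'; have [rbij radj rconn] := ri.
have ri' := partial_iso_converse ri.
have zadj w : r w -> adj w.1 z = adj w.2 z'.
  move=> rw; have ru' : converse r (u.2, u.1) by case: (u) ru.
  have rw' : converse r (w.2, w.1) by case: (w) rw.
  have z'r' : forall w, converse r w -> w.1 != z'.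
    by move=> [a b] rba; apply: (z'r (b, a)).
  apply/idP/idP => h.
  - have e1 : w.1 = u.1 by apply: (partial_iso_attach ri ru rw zr);
    rewrite adjC.
    suff -> : w.2 = u.2 by [].
    by apply/eqP; rewrite -(rbij w u)// e1.
  - have e2 : w.2 = u.2.
      by apply: (partial_iso_attach ri' ru' rw' z'r') => /=; rewrite adjC.
    suff -> : w.1 = u.1 by [].
    by apply/eqP; rewrite (rbij w u)// e2.
split.
- move=> v w [rv|->] [rw|->] /=; first exact: rbij.
  + by rewrite (negbTE (zr _ rv)) (negbTE (z'r _ rv)).
  + by rewrite eq_sym (negbTE (zr _ rw)) eq_sym (negbTE (z'r _ rw)).
  + by rewrite !eqxx.
- move=> v w [rv|->] [rw|->] /=; first exact: radj.
  + exact: zadj.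
  + by rewrite adjC zadj// adjC.
  + by rewrite !(tree_irreflexive tree).
move=> S v rv Sv Sstep.
have inl w : r w -> (r `|` [set (z, z')]) w by left.
have inr : (r `|` [set (z, z')]) (z, z') by right.
have [w rw Sw] : exists2 w, r w & S w.
  case: rv Sv => [rv|->] Sv; first by exists v.
  by exists u => //; apply: Sstep Sv _ => //; [exact: inl|rewrite /= adjC].
have rS : r `<=` S.
  apply: rconn rw Sw _ => v1 v2 r1 r2; exact: Sstep (inl _ r1) (inl _ r2).
move=> t [/rS//|->]; apply: Sstep (rS _ ru) _ => //; exact: inl.
Qed.

Lemma partial_iso_total r : partial_iso r -> r !=set0 ->
  (forall r', r `<=` r' -> partial_iso r' -> r' `<=` r) ->
  forall x, exists y, r (x, y).
Proof.
move=> ri [u0 ru0] rmax x.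
have [p u0p <-] := tree_connected tree u0.1 x.
have rclosed u z : r u -> adj u.1 z -> exists y, r (z, y).
  move=> ru uz; apply: contrapT => noy.
  have zr w : r w -> w.1 != z.
    by case: w => a b rab; apply/eqP => /= az; apply: noy; exists b;
      rewrite -az.
  have [z' uz' z'r] := partial_iso_free ri ru zr uz.
  apply: noy; exists z'.
  apply: (rmax (r `|` [set (z, z')])); [by move=> ? ?; left| |by right].
  exact: partial_iso_extend uz uz'.
have : exists y, r (u0.1, y) by exists u0.2; case: (u0) ru0.
elim: p (u0.1) u0p => [//|z p IH] a /= /andP[az zp] [b rab].
by apply: IH zp _; apply: rclosed rab _.
Qed.

(** By Zorn there is a maximal partial isomorphism containing r0; by
maximality and connectedness its domain and, applying this to the converse, its
range are all of V. *)
Lemma partial_iso_automorphism r0 : partial_iso r0 -> r0 !=set0 ->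
  exists2 f, automorphism adj f & forall u, r0 u -> f u.1 = u.2.
Proof.
move=> r0i r00.
have [|r [ri rmax]] := @Zorn_bigcup _ (fun r => partial_iso (r0 `|` r)).
  move=> F Fi Ftot.
  have pick u : (r0 `|` \bigcup_(X in F) X) u ->
      exists r, [/\ r = set0 \/ F r, (r0 `|` r) u & partial_iso (r0 `|` r)].
    move=> [u0|[X FX Xu]].
      by exists set0; split; [left|left|rewrite setU0].
    by exists X; split; [right|right|exact: Fi].
  have pick2 u v :
      (r0 `|` \bigcup_(X in F) X) u -> (r0 `|` \bigcup_(X in F) X) v ->
      exists r, [/\ r `<=` \bigcup_(X in F) X, (r0 `|` r) u, (r0 `|` r) v
                  & partial_iso (r0 `|` r)].
    move=> /pick[r [Fr ru ri]] /pick[s [Fs sv si]].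
    have sub X : X = set0 \/ F X -> X `<=` \bigcup_(X in F) X.
      by move=> [->//|FX]; exact: bigcup_sup.
    have [rs|sr] : r `<=` s \/ s `<=` r.
      case: Fr Fs => [-> _|Fr [->|Fs]]; [by left|by right|exact: Ftot].
    - exists s; split=> //; first exact: sub.
      exact: (setUS rs).
    - exists r; split=> //; first exact: sub.
      exact: (setUS sr).
  split.
  - by move=> u v /pick2 h /h[r [_ ru rv [rb _ _]]]; exact: rb.
  - by move=> u v /pick2 h /h[r [_ ru rv [_ ra _]]]; exact: ra.
  move=> S u ru Su Sstep v rv;
    have [r [rF ru' rv' [_ _ rc]]] := pick2 _ _ ru rv.
  apply: rc ru' Su _ _ rv' => w w' rw rw'; apply: Sstep.
  - exact: (setUS rF).
  - exact: (setUS rF).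
have {}rmax r' : r0 `|` r `<=` r' -> partial_iso r' -> r' `<=` r0 `|` r.
  move=> rr' r'i t r't; apply: contrapT => nt.
  apply: (rmax r'); last first.
    by rewrite setUidr// => ? ?; apply: rr'; left.
  split; last by move=> h; apply: nt; right; apply: h.
  by move=> ? ?; apply: rr'; right.
set s := r0 `|` r in ri rmax.
have s0 : s !=set0 by have [u u0] := r00; exists u; left.
have stot := partial_iso_total ri s0 rmax.
have stot' : forall y, exists x, converse s (y, x).
  apply: partial_iso_total; first exact: partial_iso_converse.
  - by have [[a b] sab] := s0; exists (b, a).
  - move=> r' sr' r'i [a b] rab.
    apply: (rmax (converse r')) => [[a' b'] sab| |//].
      by apply: sr'.
    exact: partial_iso_converse.
have [sbij sadj _] := ri.
have /choice[f fP] := stot; have /choice[g gP] := stot'.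
exists f; last first.
  case=> a b ab /=; have sab : s (a, b) by left.
  by apply/eqP; have := sbij _ _ (fP a) sab; rewrite /= eqxx => /esym.
split; last by move=> x y; rewrite -(sadj _ _ (fP x) (fP y)).
exists g => x; apply/eqP.
- by have := sbij _ _ (fP x) (gP (f x)); rewrite /= eqxx eq_sym.
- by have := sbij _ _ (fP (g x)) (gP x); rewrite /= eqxx => /esym.
Qed.

(** In a tree a simple path is an induced subgraph. *)
Lemma uniq_path_adj x p i j : path adj x p -> uniq (x :: p) ->
  (i < j <= size p)%N -> adj (nth x (x :: p) i) (nth x (x :: p) j) = (j == i.+1).
Proof.
move=> xp Up /andP[ij jp]; apply/idP/idP => [aij|/eqP ji]; last first.
  by rewrite ji in jp *; move/(pathP x): xp; apply.
case: j ij jp aij => // j; rewrite ltnS => ij jp aij.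
(* The next vertex j+1 is attached to the piece q of the path between i and j. *)
pose q := drop i (take j p).
have xiq : path adj (nth x (x :: p) i) q.
  have : path adj x (take j p).
    by rewrite -(cat_take_drop j p) cat_path in xp; case/andP: xp.
  rewrite -{1}(cat_take_drop i (take j p)) cat_path => /andP[_].
  suff -> : last x (take i (take j p)) = nth x (x :: p) i by [].
  rewrite take_takel// (last_nth x) size_takel;
    last exact: leq_trans ij (ltnW _).
  by case: (i) => //= k; rewrite nth_take.
have szq : size q = (j - i)%N by rewrite size_drop size_take jp.
have nq k : (k < j - i)%N -> nth x q k = nth x p (i + k).
  by move=> kji; rewrite nth_drop nth_take// -ltn_subRL.
have lq : last (nth x (x :: p) i) q = nth x (x :: p) j.
  rewrite (last_nth x) szq; case: ltngtP ij => // [ij _|-> _];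
    last by rewrite subnn.
  rewrite -[(j - i)%N]prednK ?subn_gt0//= nq ?prednK ?subn_gt0//.
  by case: j ij {jp aij q xiq szq nq} => // j ij; rewrite subSn//= subnKC.
have := path_attach xiq _ _ _; move/(_ (nth x (x :: p) j.+1)).
rewrite lq !(adjC (nth x (x :: p) j.+1)) aij.
have -> : adj (nth x (x :: p) j) (nth x (x :: p) j.+1).
  by move/(pathP x): xp; apply.
move=> /(_ _ isT isT) e.
suff /e/eqP : nth x (x :: p) j.+1 \notin nth x (x :: p) i :: q.
  by rewrite nth_uniq//=; lia.
apply/negP => /(nthP x)[k]; rewrite /= szq ltnS => kji.
have -> : nth x (nth x (x :: p) i :: q) k = nth x (x :: p) (i + k).
  case: k kji => [|k] kji; first by rewrite addn0.
  by rewrite /= nq// addnS.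
have ikj : (i + k <= j)%N by rewrite -(subnKC ij) leq_add2l.
move/eqP; rewrite -[nth x p j]/(nth x (x :: p) j.+1) nth_uniq//=; lia.
Qed.

(** Reversing the simple path from x to y is a partial isomorphism, which
extends to an automorphism. *)
Lemma exists_swap x y : exists f, [/\ automorphism adj f, f x = y & f y = x].
Proof.
have [p0 xp0 <-] := tree_connected tree x y.
case/shortenP: xp0 => p xp Up _ {p0}.
pose l k := nth x (x :: p) k; pose n := size p.
have ladj i j : (i <= n)%N -> (j <= n)%N ->
    adj (l i) (l j) = (j == i.+1) || (i == j.+1).
  move=> ni nj; case: (ltngtP i j) => ij.
  - rewrite uniq_path_adj ?ij// [i == _]ltn_eqF ?orbF//; exact: leq_trans ij _.
  - rewrite adjC uniq_path_adj ?ij// [j == _]ltn_eqF//; exact: leq_trans ij _.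
  - by rewrite ij (tree_irreflexive tree) ltn_eqF.
have linj i j : (i <= n)%N -> (j <= n)%N -> (l i == l j) = (i == j).
  by move=> ni nj; rewrite nth_uniq.
pose r : set (V * V) := [set (l i, l (n - i)%N) | i in [set i | (i <= n)%N]].
have ri : partial_iso r.
  split.
  - move=> _ _ [i /= ni <-] [j /= nj <-] /=; rewrite !linj ?leq_subr//.
    apply/eqP/eqP => [->//|]; lia.
  - move=> _ _ [i /= ni <-] [j /= nj <-] /=; rewrite !ladj ?leq_subr//.
    apply/idP/idP; lia.
  move=> S _ [i /= ni <-] Si Sstep.
  have step a b : (a <= n)%N -> (b <= n)%N -> adj (l a) (l b) ->
      S (l a, l (n - a)%N) -> S (l b, l (n - b)%N).
    by move=> na nb ab Sa; apply: (Sstep (l a, l (n - a)%N)) => //;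
      [exists a|exists b].
  have S0 : S (l 0%N, l (n - 0)%N).
    elim: i ni Si => // i IH ni Si; apply: IH; first exact: ltnW.
    by apply: step Si; rewrite // ?ladj ?eqxx ?orbT//; exact: ltnW.
  move=> _ [j /= nj <-]; elim: j nj => // j IH nj.
  by apply: step (IH (ltnW nj)); rewrite // ?ladj ?eqxx//; exact: ltnW.
have r0 : r (l 0%N, l n) by exists 0%N; rewrite //= subn0.
have rn : r (l n, l 0%N) by exists n; rewrite //= subnn.
have ln : l n = last x p by rewrite (last_nth x).
have [|f fauto fr] := partial_iso_automorphism ri; first by exists (l 0%N, l n).
exists f; rewrite -ln; split=> //; first exact: (fr _ r0).
exact: (fr _ rn).
Qed.

End TreeAutomorphisms.

(** * Lazy walks and clusters *)

Section Walks.
Variables (R : realType) (V : choiceType) (d : nat) (nb : V -> seq V).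
Hypothesis d_gt0 : (0 < d)%N.
Hypothesis size_nb : forall x, size (nb x) = d.

(** With d copies of x, a lazy step is a uniform choice among 2 d moves; a law
of the walk is then a plain average over a list, with multiplicities. *)
Definition moves (x : V) : seq V := nseq d x ++ nb x.

Fixpoint walk_ends (n : nat) (x : V) : seq V :=
  if n is m.+1 then flatten [seq walk_ends m y | y <- moves x] else [:: x].

Definition walk_mean (n : nat) (g : V -> R) (x : V) : R :=
  (\sum_(y <- walk_ends n x) g y) / (2 * d%:R) ^+ n.

Let w_gt0 : 0 < 2 * d%:R :> R. Proof. by rewrite mulr_gt0 ?ltr0n. Qed.

Let wn_gt0 n : 0 < (2 * d%:R) ^+ n :> R. Proof. exact: exprn_gt0. Qed.

Lemma walk_mean0 g x : walk_mean 0 g x = g x.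
Proof. by rewrite /walk_mean /= big_seq1 expr0 divr1. Qed.

Lemma walk_meanS n g x :
  walk_mean n.+1 g x = (\sum_(y <- moves x) walk_mean n g y) / (2 * d%:R).
Proof.
by rewrite /walk_mean /= big_flatten big_map -mulr_suml exprS invfM mulrA mulrAC.
Qed.

Lemma sum_moves (g : V -> R) x :
  \sum_(y <- moves x) g y = d%:R * g x + \sum_(y <- nb x) g y.
Proof. by rewrite big_cat/= big_nseq -Monoid.iteropE mulr_natl. Qed.

Lemma walk_meanD n m g x : walk_mean (n + m) g x = walk_mean n (walk_mean m g) x.
Proof.
elim: n x => [|n IH] x; first by rewrite walk_mean0.
by rewrite addSn !walk_meanS; congr (_ / _); apply: eq_bigr => y _.
Qed.

Lemma le_walk_mean n f g x : (forall y, f y <= g y) ->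
  walk_mean n f x <= walk_mean n g x.
Proof. by move=> fg; rewrite ler_pM2r ?invr_gt0//; exact: ler_sum. Qed.

Lemma walk_mean_ge0 n f x : (forall y, 0 <= f y) -> 0 <= walk_mean n f x.
Proof. by move=> f0; rewrite divr_ge0 ?sumr_ge0// ltW. Qed.

Lemma walk_mean_linear n (a : R) f g x :
  walk_mean n (fun y => a * f y + g y) x = a * walk_mean n f x + walk_mean n g x.
Proof. by rewrite /walk_mean big_split/= -mulr_sumr mulrDl mulrA. Qed.

Lemma walk_meanZ n (a : R) f x :
  walk_mean n (fun y => a * f y) x = a * walk_mean n f x.
Proof. by rewrite /walk_mean -mulr_sumr mulrA. Qed.

Lemma walk_mean_cst n (a : R) x : walk_mean n (fun=> a) x = a.
Proof.
elim: n x => [|n IH] x; first by rewrite walk_mean0.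
rewrite walk_meanS; under eq_bigr do rewrite IH.
rewrite big_const_seq count_predT size_cat size_nseq size_nb iter_addr_0.
have -> : a *+ (d + d) = a * (2 * d%:R) by rewrite -[a *+ _]mulr_natr natrD;
  ring.
by rewrite mulfK// gt_eqF.
Qed.

Section Equivariance.
Variable f : V -> V.
Hypothesis nb_equivariant : forall x, perm_eq (nb (f x)) (map f (nb x)).

Lemma walk_mean_equivariant n g x :
  walk_mean n g (f x) = walk_mean n (fun y => g (f y)) x.
Proof.
elim: n x => [|n IH] x; first by rewrite !walk_mean0.
rewrite !walk_meanS !sum_moves IH; congr (_ / _); congr (_ + _).
by rewrite (perm_big _ (nb_equivariant x))/= big_map; apply: eq_bigr.
Qed.

End Equivariance.
End Walks.

Section Clusters.
Variables (V : choiceType) (adj : rel V).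
Hypothesis adjC : symmetric adj.
Implicit Types c : set (set V).

(** Adjacency is part of the definition because a general c may contain sets
that are not edges, on which the product sigma-algebra carries no
information. *)
Definition open_edge c : rel V := fun x y => adj x y && `[< c [set x; y] >].

Definition linked c x y : bool :=
  `[< exists2 p, path (open_edge c) x p & last x p = y >].

Lemma open_edgeC c : symmetric (open_edge c).
Proof. by move=> x y; rewrite /open_edge adjC setUC. Qed.

Lemma linked_refl c x : linked c x x.
Proof. by apply/asboolP; exists [::]. Qed.

Lemma linked_trans c y x z : linked c x y -> linked c y z -> linked c x z.
Proof.
move=> /asboolP[p xp <-] /asboolP[q yq <-]; apply/asboolP.
by exists (p ++ q); rewrite ?last_cat// cat_path xp.
Qed.

Lemma linkedC c x y : linked c x y = linked c y x.
Proof.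
suff sym a b : linked c a b -> linked c b a by apply/idP/idP; exact: sym.
move=> /asboolP[p ap <-]; apply/asboolP; exists (rev (belast a p)).
  by rewrite rev_path (eq_path (e' := open_edge c))// => u v;
    rewrite open_edgeC.
by case: p {ap} => //= u p; rewrite rev_cons last_rcons.
Qed.

Lemma linked_open c x y : open_edge c x y -> linked c x y.
Proof. by move=> xy; apply/asboolP; exists [:: y]; rewrite //= xy. Qed.

Lemma cluster_linked (c : configuration adj) x y : c `<=` edges adj ->
  cluster c x y <-> linked c x y.
Proof.
move=> cE; have e : open_edge c =2 (fun x y => [set x;
  y] \in (c : set (set V))).
  move=> a b; rewrite /open_edge; apply/andP/idP => [[_ /asboolP /mem_set//]|].
  move=> /set_mem cab; split; last exact/asboolP.
  have [a' [b' [ab' abE]]] := cE _ cab.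
  have ia : [set a'; b'] a by rewrite -abE; left.
  have ib : [set a'; b'] b by rewrite -abE; right.
  have ia' : [set a; b] a' by rewrite abE; left.
  have ib' : [set a; b] b' by rewrite abE; right.
  case: ia => ia; case: ib => ib; rewrite ia ib ?ab' 1?adjC ?ab'//;
  case: ia' => h; case: ib' => h'; congruence.
split=> [[p xp <-]|/asboolP[p xp <-]].
  by apply/asboolP; exists p; rewrite // (eq_path e).
by exists p => //; rewrite -(eq_path e).
Qed.

Lemma linked_image f c x y : automorphism adj f ->
  linked [set f @` e | e in c] (f x) (f y) = linked c x y.
Proof.
move=> [[g fg gf] fadj]; have finj : injective f := can_inj fg.
have iinj (A B : set V) : f @` A = f @` B -> A = B.
  by move=> AB; apply/funext => z;
    rewrite -(image_inj (A:=A) finj) AB image_inj.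
have e : relpre f (open_edge [set f @` e | e in c]) =2 open_edge c.
  move=> a b; rewrite /open_edge /= fadj; congr (_ && _).
  rewrite -[[set f a; f b]]/([set f a] `|` [set f b]) -!image_set1 -image_setU.
  apply/asboolP/asboolP => [[e' ce' /iinj <-]//|cab].
  by exists [set a; b].
apply/asboolP/asboolP => -[p xp]; last first.
  by move=> <-; exists (map f p); rewrite ?last_map// path_map (eq_path e).
rewrite -[p](mapK gf) last_map => /finj <-; exists (map g p) => //.
by rewrite -(eq_path e) -path_map mapK.
Qed.

End Clusters.

(** * Return probabilities on a fixed configuration *)

Section ReturnProbabilities.
Variables (R : realType) (V : choiceType) (adj : rel V) (d : nat) (nb : V -> seq V).
Hypothesis d_gt0 : (0 < d)%N.
Hypothesis adjC : symmetric adj.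
Hypothesis size_nb : forall x, size (nb x) = d.
Hypothesis mem_nb : forall x y, (y \in nb x) = adj x y.
Implicit Types (c : set (set V)) (x y : V).

Local Notation mean := (walk_mean d nb).

Definition return_prob n c x : R := mean n (fun y => (linked adj c x y)%:R) x.

Let w_gt0 : 0 < 2 * d%:R :> R. Proof. by rewrite mulr_gt0 ?ltr0n. Qed.

Lemma return_prob0 c x : return_prob 0 c x = 1.
Proof. by rewrite /return_prob walk_mean0 linked_refl. Qed.

Lemma return_prob_ge0 n c x : 0 <= return_prob n c x.
Proof. by apply: walk_mean_ge0. Qed.

Lemma return_prob_le1 n c x : return_prob n c x <= 1.
Proof.
rewrite -[leRHS](walk_mean_cst d_gt0 size_nb n 1 x).
by apply: le_walk_mean => // y; case: linked.
Qed.

(** Being in the cluster at the intermediate time n is only one of the ways to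
be there at time n + m. *)
Lemma return_prob_supermul n m c x :
  mean n (fun y => (linked adj c x y)%:R * return_prob m c y) x <=
  return_prob (n + m) c x.
Proof.
rewrite /return_prob walk_meanD//; apply: le_walk_mean => // y.
case xy : (linked adj c x y); last by rewrite mul0r walk_mean_ge0.
rewrite mul1r; apply: le_walk_mean => // z.
by case yz : (linked adj c y z); rewrite ?(linked_trans xy yz).
Qed.

Lemma return_prob_move m c x y : y \in moves d nb x -> linked adj c x y ->
  return_prob m c y / (2 * d%:R) <= return_prob m.+1 c x.
Proof.
move=> xy lxy; apply: le_trans (return_prob_supermul 1 m c x).
rewrite walk_meanS// ler_pM2r ?invr_gt0//.
rewrite (big_rem y xy)/= walk_mean0 lxy mul1r lerDl sumr_ge0// => z _.
by rewrite walk_mean0 mulr_ge0// return_prob_ge0.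
Qed.

Lemma return_prob_lazy m c x : return_prob m c x / 2 <= return_prob m.+1 c x.
Proof.
apply: le_trans (return_prob_supermul 1 m c x).
rewrite walk_meanS// sum_moves walk_mean0 linked_refl mul1r.
rewrite ler_pdivlMr// [leLHS](_ : _ = d%:R * return_prob m c x); last by field.
rewrite lerDl sumr_ge0// => y _.
by rewrite walk_mean0 mulr_ge0// return_prob_ge0.
Qed.

Lemma return_prob_lazyn j m c x :
  return_prob m c x / 2 ^+ j <= return_prob (m + j) c x.
Proof.
elim: j => [|j IH]; first by rewrite expr0 divr1 addn0.
rewrite addnS; apply: le_trans (return_prob_lazy _ _ _).
by rewrite exprS invfM mulrCA mulrC ler_pM2r// invr_gt0.
Qed.

Lemma return_prob_ge n c x : 2^-1 ^+ n <= return_prob n c x.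
Proof. by have := return_prob_lazyn n 0 c x;
  rewrite return_prob0 add0n div1r exprVn. Qed.

Lemma return_prob_gt0 n c x : 0 < return_prob n c x.
Proof. by apply: lt_le_trans (return_prob_ge n c x); rewrite exprn_gt0. Qed.

(** The factor C makes this a property of the cluster: the exact condition with
C = 1 could depend on the starting point. *)
Definition slow_return r c x :=
  exists C : nat, forall N,
    exists2 m, (N <= m)%N & return_prob m c x <= C%:R * r ^+ m.

Lemma slow_return_open r c x y : 0 < r -> open_edge adj c x y ->
  slow_return r c x -> slow_return r c y.
Proof.
move=> r0 xy [C Cx].
have lxy := linked_open xy.
have yx : y \in moves d nb x by rewrite mem_cat mem_nb; case/andP: xy => ->;
  rewrite orbT.
exists (Num.bound (2 * d%:R * C%:R * r)) => N; have [[//|m] Nm mx] := Cx N.+1.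
exists m => //; have := le_trans (return_prob_move m yx lxy) mx.
rewrite ler_pdivrMr// => /le_trans; apply.
rewrite exprS [leLHS](_ : _ = 2 * d%:R * C%:R * r * r ^+ m); last by ring.
rewrite ler_pM2r ?exprn_gt0// ltW// archi_boundP//.
by rewrite !mulr_ge0// ltW.
Qed.

Lemma slow_return_linked r c x y : 0 < r -> linked adj c x y ->
  slow_return r c x <-> slow_return r c y.
Proof.
suff sub a b : 0 < r -> linked adj c a b -> slow_return r c a -> slow_return r c b.
  by move=> r0 xy; split; apply: sub; rewrite // linkedC.
move=> r0 /asboolP[p + <-]; elim: p a => //= z p IH a /andP[az zp] sa.
exact: IH zp (slow_return_open r0 az sa).
Qed.

(** For s > 0, positive exactly when the return probability at time n k is
below s^(n k). *)
Definition excess n k s c x : R :=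
  k%:R * ln (s ^+ n) - ln (return_prob (n * k) c x).

Fixpoint max_excess n N s c x : R :=
  if N is k.+1 then Num.max (max_excess n k s c x) (excess n k.+1 s c x) else 0.

Lemma max_excess_ge0 n N s c x : 0 <= max_excess n N s c x.
Proof. by elim: N => //= N IH; rewrite le_max IH. Qed.

Lemma max_excess_homo n N M s c x : (N <= M)%N ->
  max_excess n N s c x <= max_excess n M s c x.
Proof.
elim: M => [|M IH]; first by case: N.
by rewrite leq_eqVlt => /predU1P[->//|/IH h]; rewrite /= le_max h.
Qed.

Lemma le_max_excess n N k s c x : (0 < k <= N)%N ->
  excess n k s c x <= max_excess n N s c x.
Proof.
case: k => // k kN; apply: le_trans (max_excess_homo n s c x kN).
by rewrite /= le_max lexx orbT.
Qed.

Lemma max_excess_attained n N s c x : 0 < max_excess n N s c x ->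
  exists2 k, (k < N)%N & max_excess n N s c x = excess n k.+1 s c x.
Proof.
elim: N => [|N IH]; first by rewrite ltxx.
rewrite /= maxEle; case: ifP => _; first by exists N.
by move=> /IH[k kN ->]; exists k => //; exact: ltnW.
Qed.

(** The tangent to the logarithm at b lies above its graph; every use of
concavity below goes through this form. *)
Lemma ln_le_tangent (a b : R) : 0 < a -> 0 < b -> ln a <= ln b + (a / b - 1).
Proof.
move=> a0 b0; rewrite -lerBlDl -ln_div// -[X in ln X](addrNK 1) addrC.
apply: le_ln1Dx; rewrite ltrBrDr addNr divr_gt0//.
Qed.

(** Let p be the return probability at time n and m the mean of the return
probabilities at time n k over the walk at time n conditioned to be in the
cluster.  Supermultiplicativity gives ln p + ln m as a lower bound for the
logarithm at time n (k + 1), and Jensen bounds ln m from below by the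
conditional mean of the logarithms at time n k.  The term s^n - p comes from
the same tangent inequality, applied to p (ln s^n - ln p). *)
Lemma excess_drift n k (s : R) c x : 0 < s ->
  return_prob n c x * excess n k.+1 s c x <=
  s ^+ n - return_prob n c x +
    mean n (fun y => (linked adj c x y)%:R * excess n k s c y) x.
Proof.
move=> s0; set p := return_prob n c x.
have p0 : 0 < p by exact: return_prob_gt0.
set A := mean n (fun y => (linked adj c x y)%:R * return_prob (n * k) c y) x.
have A0 : 0 < A.
  apply: (@lt_le_trans _ _ (2^-1 ^+ (n * k) * p));
    first by rewrite mulr_gt0// exprn_gt0.
  rewrite -walk_meanZ; apply: le_walk_mean => // y.
  by rewrite mulrC ler_wpM2l// return_prob_ge.
pose m := A / p; have m0 : 0 < m by rewrite divr_gt0.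
have Am : A <= return_prob (n * k.+1) c x by rewrite mulnS;
  exact: return_prob_supermul.
have lnA : ln p + ln m <= ln (return_prob (n * k.+1) c x).
  rewrite -lnM ?posrE// [p * m]mulrC divfK ?gt_eqF// ler_ln ?posrE//.
  exact: return_prob_gt0.
pose t := ln (s ^+ n).
(* Tangent at m: averaging ln a <= ln m + (a / m - 1) over the cluster, the
   last bracket has mean 0 by the choice of m. *)
have jensen : p * (k%:R * t - ln m) <=
    mean n (fun y => (linked adj c x y)%:R * excess n k s c y) x.
  have -> : p * (k%:R * t - ln m) =
      mean n (fun y => (- m^-1) * ((linked adj c x y)%:R * return_prob (n * k) c y) +
          ((k%:R * t - ln m + 1) * (linked adj c x y)%:R + 0)) x.
    rewrite !walk_mean_linear// walk_mean_cst// -/A -/(return_prob n c x) -/p /m.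
    by field; rewrite !gt_eqF.
  apply: le_walk_mean => // y; case: linked;
    rewrite ?mul0r ?mulr0 ?addr0 ?mulr1 ?mul1r//.
  have := ln_le_tangent (return_prob_gt0 (n * k) c y) m0.
  rewrite /excess -/t; lra.
apply: (@le_trans _ _ (s ^+ n - p + p * (k%:R * t - ln m))); last first.
  by rewrite lerD2l.
have pt : p * (t - ln p) <= s ^+ n - p.
  have sn0 : 0 < s ^+ n by exact: exprn_gt0.
  have := ln_le_tangent sn0 p0; rewrite -/t => h.
  have -> : s ^+ n - p = p * (s ^+ n / p - 1) by field; rewrite gt_eqF.
  by rewrite ler_pM2l//; lra.
apply: (@le_trans _ _ (p * (t - ln p) + p * (k%:R * t - ln m))); last first.
  by rewrite lerD2r.
rewrite -mulrDr ler_pM2l// /excess -/t -natr1; lra.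
Qed.

(** Garsia's step.  Where the maximum is positive it is some excess with index
k + 1, which the drift inequality bounds by the mean of the excess of index k,
hence by the mean of the maximum; elsewhere the left side vanishes.  Index 0 is
harmless because the excess is then 0. *)
Lemma maximal_inequality n N (s : R) c x : 0 < s ->
  return_prob n c x * max_excess n N s c x <=
  (0 < max_excess n N s c x)%R%:R * (s ^+ n - return_prob n c x) +
    mean n (fun y => (linked adj c x y)%:R * max_excess n N s c y) x.
Proof.
move=> s0.
have mean_ge0 :
    0 <= mean n (fun y => (linked adj c x y)%:R * max_excess n N s c y) x.
  by apply: walk_mean_ge0 => // y; rewrite mulr_ge0// max_excess_ge0.
have [M0|M0] := ltrP 0 (max_excess n N s c x); last first.
  have -> : max_excess n N s c x = 0 by apply/le_anti;
    rewrite M0 max_excess_ge0.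
  by rewrite mulr0 mul0r add0r.
have [k kN ->] := max_excess_attained M0; rewrite mul1r.
apply: le_trans (excess_drift _ _ _ _ s0) _; rewrite lerD2l.
apply: le_walk_mean => // y; apply: ler_wpM2l => //.
case: k kN => [|k] kN; last by apply: le_max_excess; exact: ltnW.
by rewrite /excess muln0 return_prob0 ln1 mul0r subr0 max_excess_ge0.
Qed.

(** A slow time m need not be a multiple of n.  Rounding it down to n k loses at
most a factor 2^n in the return probability, by laziness, and (1 + r)^n in
r^m; the gap between r and s absorbs both, and C, once m is large. *)
Lemma slow_return_excess n r s c x : (0 < n)%N -> 0 < r < s -> slow_return r c x ->
  exists N, 0 < max_excess n N s c x.
Proof.
move=> n0 /andP[r0 rs] [C slow]; have s0 : 0 < s := lt_trans r0 rs.
(* K collects the constants lost in the rounding. *)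
pose K := (2 ^+ n * C%:R * (1 + r) ^+ n).
have K0 : 0 <= K by rewrite !mulr_ge0// exprn_ge0// addr_ge0// ltW.
have [M0 smallq] : exists M0, forall l, (M0 <= l)%N -> K * r ^+ l < s ^+ l.
  have q1 : `|r / s| < 1 by rewrite ger0_norm ?divr_ge0 ?ltW// ltr_pdivrMr// mul1r.
  have : (fun l => K * (r / s) ^+ l) @ \oo --> K * 0.
    by apply: cvgMr; exact: cvg_expr.
  rewrite mulr0 => /cvgr_lt/(_ 1 ltr01)[M0 _ hM0]; exists M0 => l /hM0 /=.
  by rewrite exprMn exprVn mulrA ltr_pdivrMr ?exprn_gt0// mul1r.
have [m] := slow (M0 + n + n)%N; rewrite (divn_eq m n); set k := (m %/ n)%N;
  set j := (m %% n)%N.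
have jn : (j < n)%N by rewrite ltn_mod.
move=> mN mC.
have kM : (M0 <= n * k)%N by move: mN jn; rewrite mulnC; lia.
have k0 : (0 < k)%N by case: (k) mN jn => //; lia.
exists k; apply: lt_le_trans (le_max_excess _ _ _ _ (N := k) (k := k) _);
  last by rewrite k0 leqnn.
rewrite /excess subr_gt0 mulr_natl -lnXn ?exprn_gt0//.
rewrite ltr_ln ?posrE ?return_prob_gt0 ?exprn_gt0// -exprM.
apply: le_lt_trans (smallq _ kM).
have := le_trans (return_prob_lazyn j (k * n) c x) mC.
rewrite ler_pdivrMr ?exprn_gt0// mulnC => /le_trans; apply.
have rj : r ^+ j * 2 ^+ j <= (1 + r) ^+ n * 2 ^+ n.
  apply: ler_pM; [by rewrite exprn_ge0// ltW|exact: exprn_ge0| |].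
  - apply: (@le_trans _ _ ((1 + r) ^+ j)); first by rewrite lerXn2r// ?nnegrE;
    lra.
    by rewrite ler_weXn2l//; [lra|exact: ltnW].
  - by rewrite ler_weXn2l//; [lra|exact: ltnW].
rewrite exprD [leLHS](_ : _ = (C%:R * r ^+ (n * k)) * (r ^+ j * 2 ^+ j));
  last by ring.
rewrite [leRHS](_ : _ = (C%:R * r ^+ (n * k)) * ((1 + r) ^+ n * 2 ^+ n));
  last first.
  by rewrite /K; ring.
by rewrite ler_wpM2l// mulr_ge0// exprn_ge0// ltW.
Qed.

End ReturnProbabilities.

(** * Equivariance and measurability *)

Section ReturnEquivariance.
Variables (R : realType) (V : choiceType) (adj : rel V) (d : nat) (nb : V -> seq V).
Hypothesis uniq_nb : forall x, uniq (nb x).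
Hypothesis mem_nb : forall x y, (y \in nb x) = adj x y.
Variable f : V -> V.
Hypothesis fauto : automorphism adj f.
Implicit Types (c : set (set V)) (x y : V).

Lemma neighbours_equivariant x : perm_eq (nb (f x)) (map f (nb x)).
Proof.
have [[g fg gf] fadj] := fauto.
apply: uniq_perm; rewrite ?map_inj_uniq//; first exact: can_inj fg.
move=> y; rewrite -(gf y) mem_map; last exact: can_inj fg.
by rewrite !mem_nb fadj.
Qed.

Lemma return_prob_equivariant n c x :
  return_prob R adj d nb n [set f @` e | e in c] (f x) = return_prob R adj d nb n c x.
Proof.
rewrite /return_prob (walk_mean_equivariant _ neighbours_equivariant).
by congr walk_mean; apply/funext => y; rewrite linked_image.
Qed.

Lemma slow_return_equivariant r c x :
  slow_return adj d nb r [set f @` e | e in c] (f x) = slow_return adj d nb (r : R) c x.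
Proof.
apply/propext; split=> -[C h]; exists C => N; have [m Nm hm] := h N;
  exists m => //.
  by rewrite -(return_prob_equivariant m c x).
by rewrite return_prob_equivariant.
Qed.

Lemma max_excess_equivariant n N s c x :
  max_excess adj d nb n N s [set f @` e | e in c] (f x) =
  max_excess adj d nb n N (s : R) c x.
Proof. by elim: N => //= N ->; rewrite /excess return_prob_equivariant. Qed.

End ReturnEquivariance.

Section Measurability.
Variables (R : realType) (V : choiceType) (adj : rel V) (d : nat) (nb : V -> seq V).
Hypothesis mem_nb : forall x y, (y \in nb x) = adj x y.

Lemma measurable_edge x y : adj x y ->
  measurable [set c : configuration adj | c [set x; y]].
Proof.
by move=> xy; apply: sub_sigma_algebra; exists [set x; y] => //; exists x, y.
Qed.

(** Local finiteness leaves finitely many paths of each length, so the event is a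
countable union of finite intersections of cylinders. *)
Lemma measurable_linked x y :
  measurable [set c : configuration adj | linked adj c x y].
Proof.
pose L n x : set (configuration adj) :=
  [set c | exists p, [/\ size p = n, path (open_edge adj c) x p & last x p = y]].
have -> : [set c : configuration adj | linked adj c x y] = \bigcup_n L n x.
  apply/seteqP; split=> [c /asboolP[p xp py]|c [n _ [p [_ xp py]]]].
    by exists (size p) => //; exists p.
  by apply/asboolP; exists p.
apply: bigcup_measurable => n _; elim: n x => [|n IH] x.
  have [->|xy] := eqVneq x y.
    rewrite (_ : L _ _ = setT)//; apply/seteqP; split=> // c _; by exists [::].
  rewrite (_ : L _ _ = set0)//; apply/seteqP;
    split=> // c [p [/size0nil-> _ /= /eqP]].
  by rewrite (negbTE xy).
have -> : L n.+1 x = \bigcup_(z in [set` nb x])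
    ([set c : configuration adj | c [set x; z]] `&` L n z).
  apply/seteqP; split=> [c [[|z p] [//= [sp] /andP[/andP[xz /asboolP cxz] zp] py]]|].
    by exists z; [rewrite /= mem_nb|split => //; exists p].
  move=> c [z /=]; rewrite mem_nb => xz [cxz [p [sp zp py]]].
  exists (z :: p); split=> //=; first by rewrite sp.
  by rewrite /open_edge xz zp andbT; exact/asboolP.
apply: fin_bigcup_measurable; first exact: finite_seq.
move=> z /=; rewrite mem_nb => xz; apply: measurableI; last exact: IH.
exact: measurable_edge.
Qed.

Lemma measurable_fun_linked x y :
  measurable_fun setT (fun c : configuration adj => (linked adj c x y)%:R : R).
Proof.
have -> : (fun c : configuration adj => (linked adj c x y)%:R : R) =
    \1_[set c : configuration adj | linked adj c x y].
  apply/funext => c; rewrite indicE; congr (nat_of_bool _)%:R.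
  by apply/idP/idP => [?|/set_mem//]; exact/mem_set.
exact: measurable_indic (measurable_linked x y).
Qed.

Lemma measurable_walk_mean n (g : configuration adj -> V -> R) x :
  (forall y, measurable_fun setT (g ^~ y)) ->
  measurable_fun setT (fun c => walk_mean d nb n (g c) x).
Proof.
move=> mg; apply: measurable_funM => //; exact: measurable_sum.
Qed.

Lemma measurable_return_prob n x : measurable_fun setT
  (fun c : configuration adj => return_prob R adj d nb n c x).
Proof. by apply: measurable_walk_mean => y; exact: measurable_fun_linked. Qed.

Lemma measurable_max_excess n N (s : R) x : measurable_fun setT
  (fun c : configuration adj => max_excess adj d nb n N s c x).
Proof.
elim: N => [|N IH] /=; first exact: measurable_cst.
apply: measurable_maxr => //; apply: measurable_funB => //.
apply: measurableT_comp; [exact: measurable_ln|exact: measurable_return_prob].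
Qed.

Lemma measurable_slow_return (r : R) x :
  measurable [set c : configuration adj | slow_return adj d nb r c x].
Proof.
have -> : [set c : configuration adj | slow_return adj d nb r c x] =
    \bigcup_C \bigcap_N \bigcup_(m in [set m | (N <= m)%N])
      [set c : configuration adj | return_prob R adj d nb m c x <= C%:R * r ^+ m].
  apply/seteqP; split=> [c [C h]|c [C _ h]].
    by exists C => // N _; have [m] := h N; exists m.
  by exists C => N; have [m] := h N I; exists m.
apply: bigcup_measurable => C _; apply: bigcap_measurable => // N _.
apply: bigcup_measurable => m _; rewrite -[X in measurable X]setTI.
by apply: measurable_fun_le => //; exact: measurable_return_prob.
Qed.

Lemma measurable_move_edges f : automorphism adj f ->
  measurable_fun setT (@move_edges V adj f : configuration adj -> configuration adj).
Proof.
move=> [[g fg gf] fadj]; 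
apply: (@measurability _ _ (configuration adj) (configuration adj)
  setT _ (edge_cylinders adj)) => //.
move=> _ [_ [_ [x [y [xy ->]]] <-] <-]; rewrite setTI.
rewrite (_ : _ @^-1` _ = [set c : configuration adj | c [set g x; g y]]).
  by apply: measurable_edge; rewrite -fadj !gf.
have im : f @` [set g x; g y] = [set x; y].
  by rewrite image_setU !image_set1 !gf.
apply/seteqP; split=> c /=.
  move=> [e ce exy]; suff <- : e = [set g x; g y] by [].
  apply/funext => z; rewrite -[LHS](image_inj (can_inj fg)) exy -im.
  by rewrite image_inj//; exact: can_inj fg.
by move=> cxy; exists [set g x; g y].
Qed.

End Measurability.

(** * The maximal inequality for an invariant percolation *)

Section IntegralComparison.
Variables (dsp : measure_display) (T : measurableType dsp) (R : realType).
Variable P : probability T R.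

Lemma integral_cst_probability (k : \bar R) : (\int[P]_w cst k w = k)%E.
Proof.
rewrite integral_cst// -[RHS]mule1; congr (_ * _)%E; exact: probability_setT.
Qed.

(** The integrals live in the extended reals, so cancelling the equal terms
needs them to be finite; this is why a is bounded. *)
Lemma le_integral_cancel (K : R) (a b u v : T -> R) :
  measurable_fun setT a -> measurable_fun setT b ->
  measurable_fun setT u -> measurable_fun setT v ->
  (forall w, 0 <= a w <= K) -> (forall w, 0 <= b w) ->
  (forall w, 0 <= u w) -> (forall w, 0 <= v w) ->
  (\int[P]_w (a w)%:E = \int[P]_w (b w)%:E)%E ->
  (forall w, a w + u w <= v w + b w) ->
  (\int[P]_w (u w)%:E <= \int[P]_w (v w)%:E)%E.
Proof.
move=> /measurable_EFinP ma /measurable_EFinP mb.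
move=> /measurable_EFinP mu /measurable_EFinP mv.
move=> aK b0 u0 v0 ab auvb.
have afin : (\int[P]_w (a w)%:E)%E \is a fin_num.
  rewrite ge0_fin_numE; last first.
    by apply: integral_ge0 => w _; rewrite lee_fin; have /andP[] := aK w.
  apply: (@le_lt_trans _ _ (\int[P]_w (cst K%:E w))%E).
    apply: ge0_le_integral => // w _; rewrite lee_fin; by have /andP[] := aK w.
  by rewrite integral_cst_probability ltry.
rewrite -(@leeD2lE _ _ _ _ afin) {2}ab.
rewrite -ge0_integralD// -1?ge0_integralD//;
  try by move=> w _; rewrite lee_fin//; have /andP[] := aK w.
apply: ge0_le_integral => //.
- by move=> w _; rewrite adde_ge0// lee_fin//; have /andP[] := aK w.
- exact: emeasurable_funD.
- exact: emeasurable_funD.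
by move=> w _; rewrite -!EFinD lee_fin [leRHS]addrC.
Qed.

End IntegralComparison.

Section InvariantPercolation.
Variables (V : choiceType) (adj : rel V) (d : nat) (nb : V -> seq V).
Hypothesis d_gt0 : (0 < d)%N.
Hypothesis tree : is_regular_tree adj d.
Hypothesis uniq_nb : forall x, uniq (nb x).
Hypothesis size_nb : forall x, size (nb x) = d.
Hypothesis mem_nb : forall x y, (y \in nb x) = adj x y.
Variables (R : realType) (dsp : measure_display) (T : measurableType dsp).
Variables (P : probability T R) (E : T -> configuration adj).
Hypothesis EP : invariant_percolation P E.

Local Notation conf := (configuration adj).
Local Notation ret := (return_prob R adj d nb).
Local Notation slow r := (slow_return adj d nb (r : R)).

Let mE : measurable_fun setT E := percolation_measurable EP.
Let adjC : symmetric adj := tree_symmetric tree.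

Lemma measurable_percolation (h : conf -> R) : measurable_fun setT h ->
  measurable_fun setT (fun w => (h (E w))%:E).
Proof. by move=> mh; apply/measurable_EFinP; exact: measurableT_comp mh mE. Qed.

Lemma integral_move_edges f (h : conf -> R) : automorphism adj f ->
  measurable_fun setT h -> (forall c, 0 <= h c) ->
  (\int[P]_w (h (move_edges f (E w)))%:E = \int[P]_w (h (E w))%:E)%E.
Proof.
move=> fauto mh h0; have mfE := measurableT_comp (measurable_move_edges fauto) mE.
have mhE : measurable_fun setT (EFin \o h) by apply/measurable_EFinP.
have h0' : {in setT, forall c, (0 <= (EFin \o h) c)%E}.
  by move=> c _; rewrite lee_fin.
rewrite -[LHS](ge0_integral_pushforward mfE P measurableT mhE h0').
rewrite -[RHS](ge0_integral_pushforward mE P measurableT mhE h0').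
apply: eq_measure_integral => A mA _;
  exact: percolation_invariant EP f fauto A mA.
Qed.

(** The automorphism exchanging o and y shows that F o y and F y o have the same
expectation, for each endpoint y of a walk separately. *)
Lemma mass_transport n o (F : conf -> V -> V -> R) :
  (forall x y, measurable_fun setT (fun c => F c x y)) ->
  (forall c x y, 0 <= F c x y) ->
  (forall f, automorphism adj f ->
    forall c x y, F (move_edges f c) (f x) (f y) = F c x y) ->
  (\int[P]_w (walk_mean d nb n (F (E w) o) o)%:E =
   \int[P]_w (walk_mean d nb n (fun y => F (E w) y o) o)%:E)%E.
Proof.
move=> mF F0 Finv.
have swap y : (\int[P]_w (F (E w) o y)%:E = \int[P]_w (F (E w) y o)%:E)%E.
  have [f [fauto fo fy]] := exists_swap tree o y.
  rewrite -(integral_move_edges fauto (mF o y))//.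
  by apply: eq_integral => w _; rewrite -(Finv f fauto (E w) y o) fo fy.
have int_mean (G : conf -> V -> R) : (forall y, measurable_fun setT (G ^~ y)) ->
    (forall c y, 0 <= G c y) ->
    (\int[P]_w (walk_mean d nb n (G (E w)) o)%:E =
     ((2 * d%:R) ^- n)%:E * \sum_(y <- walk_ends d nb n o) \int[P]_w (G (E w) y)%:E)%E.
  move=> mG G0; have mGE y := measurable_percolation (mG y).
  rewrite -(ge0_integral_sum P measurableT mGE); last by move=> y w _;
    rewrite lee_fin.
  rewrite -ge0_integralZl_EFin//.
  - by apply: eq_integral => w _; rewrite /walk_mean mulrC EFinM sumEFin.
  - by move=> w _; apply: sume_ge0 => y _; rewrite lee_fin.
  - exact: emeasurable_sum.
rewrite (int_mean (fun c y => F c o y))// (int_mean (fun c y => F c y o))//.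
by congr (_ * _)%E; apply: eq_bigr.
Qed.

(** Laziness keeps the return probability at time m above 2^(-m). *)
Lemma max_excess_bounded n N (s : R) :
  exists K, forall c x, max_excess adj d nb n N s c x <= K.
Proof.
elim: N => [|N [K hK]]; first by exists 0.
exists (K + `|N.+1%:R * ln (s ^+ n) - ln (2^-1 ^+ (n * N.+1))|) => c x.
have K0 : 0 <= K by apply: le_trans (hK c x); exact: max_excess_ge0.
rewrite /= ge_max; apply/andP; split;
  first by rewrite (le_trans (hK c x))// lerDl.
apply: (@le_trans _ _ (N.+1%:R * ln (s ^+ n) - ln (2^-1 ^+ (n * N.+1))));
  last first.
  by rewrite (le_trans (ler_norm _))// lerDr.
rewrite /excess lerD2l lerN2 ler_ln ?posrE ?exprn_gt0//.
  exact: return_prob_ge.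
exact: return_prob_gt0.
Qed.

(** For n > 0 and fixed r < s these events increase with N to the
event that the cluster of o is slow. *)
Definition slow_before n N (r s : R) (o : V) : set conf :=
  [set c | slow r c o /\ 0 < max_excess adj d nb n N s c o].

Lemma measurable_slow_before n N r s o : measurable (slow_before n N r s o).
Proof.
have -> : slow_before n N r s o = [set c : conf | slow r c o] `&`
    ~` (setT `&` [set c : conf | max_excess adj d nb n N s c o <= 0]).
  rewrite setTI; apply/seteqP; split=> c [sc Mc]; split=> //=.
    by apply/negP; rewrite -ltNge.
  by rewrite ltNge; exact/negP.
apply: measurableI; first exact: measurable_slow_return.
by apply: measurableC; apply: measurable_fun_le => //;
  exact: measurable_max_excess.
Qed.

(** The mass sent from x to y is the maximal excess at x if y is in the cluster
of x and that cluster is slow.  Slowness being a property of the cluster, the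
mass o receives is the mean of the maximal excess over its cluster, the last
term of the maximal inequality. *)
Lemma return_prob_slow_before n N r s o : 0 < r -> 0 < s ->
  (\int[P]_w (\1_(slow_before n N r s o) (E w) * ret n (E w) o)%:E <= (s ^+ n)%:E)%E.
Proof.
move=> r0 s0; set D := slow_before n N r s o.
have mD : measurable D by exact: measurable_slow_before.
pose M := max_excess adj d nb n N s.
pose B x := \1_[set c : conf | slow r c x] : conf -> R.
have mB x : measurable_fun setT (B x).
  by apply: measurable_indic; exact: measurable_slow_return.
have mM x : measurable_fun setT (fun c : conf => M c x).
  by exact: measurable_max_excess.
have mR x : measurable_fun setT (fun c : conf => ret n c x).
  by exact: measurable_return_prob.
have M0 c x : 0 <= M c x by exact: max_excess_ge0.
have B0 x c : 0 <= B x c by rewrite /B indicE.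
pose F (c : conf) x y := B x c * (linked adj c x y)%:R * M c x.
have mF x y : measurable_fun setT (fun c => F c x y).
  apply: measurable_funM => //; apply: measurable_funM => //.
  exact: measurable_fun_linked.
have F0 c x y : 0 <= F c x y by rewrite !mulr_ge0.
have Finv f : automorphism adj f ->
    forall c x y, F (move_edges f c) (f x) (f y) = F c x y.
  move=> fauto c x y; rewrite /F /M /B /move_edges.
  rewrite (max_excess_equivariant d uniq_nb mem_nb fauto).
  rewrite linked_image// !indicE; congr (_%:R * _ * _).
  rewrite (_ : (_ \in _) = (c \in [set c : conf | slow r c x]))//.
  by apply/idP/idP => /set_mem sc; apply/mem_set; move: sc;
    rewrite /= (slow_return_equivariant d uniq_nb mem_nb fauto).
pose a c := walk_mean d nb n (F c o) o.
pose b c := walk_mean d nb n (fun y => F c y o) o.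
have ab : (\int[P]_w (a (E w))%:E = \int[P]_w (b (E w))%:E)%E by exact: mass_transport.
have aE c : a c = B o c * (ret n c o * M c o).
  rewrite /a (_ : F c o = fun y => B o c * M c o * (linked adj c o y)%:R);
    last first.
    by apply/funext => y; rewrite /F mulrAC.
  by rewrite walk_meanZ -/(return_prob R adj d nb n c o) -mulrA [M c o * _]mulrC.
have bE c : b c = B o c * walk_mean d nb n (fun y => (linked adj c o y)%:R * M c y) o.
  rewrite /b -walk_meanZ; congr walk_mean; apply/funext => y.
  rewrite /F (linkedC adjC) -mulrA.
  case lyo : (linked adj c o y); rewrite ?mul0r ?mulr0// !mul1r /B !indicE.
  congr (_%:R * _); rewrite (_ : (_ \in _) = (c \in [set c : conf | slow r c o]))//.
  have oy := slow_return_linked d_gt0 adjC mem_nb r0 lyo.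
  by apply/idP/idP => /set_mem /oy h; exact/mem_set.
have pointwise c : a c + \1_D c * ret n c o <= s ^+ n * \1_D c + b c.
  have DE : \1_D c = B o c * (0 < M c o)%R%:R :> R.
    rewrite /B !indicE -natrM mulnb; congr (nat_of_bool _)%:R.
    apply/idP/andP => [/set_mem[h1 h2]|[/set_mem h1 h2]]; last exact/mem_set.
    by split=> //; exact/mem_set.
  have := maximal_inequality adj d_gt0 size_nb n N c o s0.
  move=> /(ler_wpM2l (B0 o c)); rewrite aE bE DE -/(M c o); lra.
have ma : measurable_fun setT a by exact: measurable_walk_mean.
have mb : measurable_fun setT b by apply: measurable_walk_mean.
have a0 c : 0 <= a c by apply: walk_mean_ge0.
have b0 c : 0 <= b c by apply: walk_mean_ge0.
have mDf : measurable_fun setT (\1_D : conf -> R) by exact: measurable_indic.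
have D0 c : 0 <= (\1_D c : R) by rewrite indicE.
have ret0 c : 0 <= ret n c o by exact: return_prob_ge0.
have mDr : measurable_fun setT (fun c : conf => \1_D c * ret n c o).
  by exact: measurable_funM.
have mDs : measurable_fun setT (fun c : conf => s ^+ n * \1_D c : R).
  by exact: measurable_funM.
have sn0 : 0 <= s ^+ n by rewrite exprn_ge0// ltW.
have [K hK] := max_excess_bounded n N s.
have aK c : 0 <= a c <= K.
  rewrite a0 aE /=; apply: le_trans (hK c o).
  rewrite mulrA ler_piMl// mulr_ile1//; first by rewrite /B indicE;
    case: (_ \in _).
  exact: return_prob_le1.
have mc (h : conf -> R) : measurable_fun setT h -> measurable_fun setT (h \o E).
  by move=> mh; exact: measurableT_comp mh mE.
apply: (le_trans (le_integral_cancel (mc _ ma) (mc _ mb) (mc _ mDr) (mc _ mDs)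
  (fun w => aK (E w)) _ _ _ ab _)) => /=.
- by [].
- by move=> w; rewrite mulr_ge0.
- by move=> w; rewrite mulr_ge0.
- by [].
apply: (@le_trans _ _ (\int[P]_w (cst (s ^+ n)%:E w))%E); last first.
  by rewrite integral_cst_probability.
apply: ge0_le_integral => //.
- by move=> w _; rewrite lee_fin mulr_ge0.
- exact: measurable_percolation mDs.
- by move=> w _; rewrite lee_fin ler_piMr// indicE; case: (_ \in _).
Qed.

(** Markov's inequality, after N has tended to infinity. *)
Lemma slow_return_rarely_high n r s t o : (0 < n)%N -> 0 < r < s -> 0 < t ->
  (P [set w | slow r (E w) o /\ (t ^+ n <= ret n (E w) o)%R] <= ((s / t) ^+ n)%:E)%E.
Proof.
move=> n0 /andP[r0 rs] t0; have s0 : 0 < s := lt_trans r0 rs.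
pose H : set conf := [set c | t ^+ n <= ret n c o].
have mH : measurable H.
  rewrite -[X in measurable X]setTI; apply: measurable_fun_le => //.
  exact: measurable_return_prob.
pose A N := E @^-1` (slow_before n N r s o `&` H).
have mA N : measurable (A N).
  rewrite -[X in measurable X]setTI; apply: mE => //.
  by apply: measurableI => //; exact: measurable_slow_before.
have AE : [set w | slow r (E w) o /\ t ^+ n <= ret n (E w) o] = \bigcup_N A N.
  apply/seteqP; split=> [w [sw Hw]|w [N _ [[sw _] Hw]]]; last by [].
  have [N hN] := slow_return_excess d_gt0 n0 (introT andP (conj r0 rs)) sw.
  by exists N.
rewrite AE; have mUA : measurable (\bigcup_N A N) by exact: bigcup_measurable.
have Ahomo : {homo A : n m / (n <= m)%N >-> (n <= m)%O}.
  move=> N M NM; apply/subsetPset => w [[sw ew] Hw]; split=> //; split=> //.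
  exact: lt_le_trans ew (max_excess_homo _ _ _ _ _ _ _ NM).
have /cvg_lim <- // := nondecreasing_cvg_mu (mu := P) mA mUA Ahomo.
apply: lime_le; first by apply: cvgP; exact: nondecreasing_cvg_mu mA mUA Ahomo.
apply: nearW => N /=.
have tn0 : 0 < t ^+ n by exact: exprn_gt0.
pose g w := \1_(slow_before n N r s o) (E w) * ret n (E w) o.
have mg : measurable_fun setT (EFin \o g).
  apply: (measurable_percolation
    (h := fun c => \1_(slow_before n N r s o) c * ret n c o)).
  apply: measurable_funM => //.
    by apply: measurable_indic; exact: measurable_slow_before.
  exact: measurable_return_prob.
have g0 w : 0 <= g w by rewrite mulr_ge0 ?indicE//; exact: return_prob_ge0.
have -> : P (A N) = (\int[P]_w (\1_(A N) w)%:E)%E by rewrite integral_indic// setIT.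
apply: (@le_trans _ _ (\int[P]_w ((t ^- n)%:E * (EFin \o g) w))%E).
  apply: ge0_le_integral => //.
  - by apply/measurable_EFinP; exact: measurable_indic.
  - exact: measurable_funeM.
  move=> w _; rewrite /= -EFinM lee_fin indicE.
  have [wA|wA] := boolP (w \in A N); last by rewrite mulr_ge0// invr_ge0 ltW.
  have [Dw Hw] := set_mem wA.
  by rewrite /g indicE mem_set// mul1r mulrC ler_pdivlMr// mul1r.
rewrite ge0_integralZl_EFin//; [|by move=> w _;
  rewrite lee_fin|by rewrite invr_ge0 ltW].
rewrite expr_div_n mulrC EFinM lee_pmul2l ?lte_fin ?invr_gt0//.
exact: return_prob_slow_before.
Qed.

(** Borel-Cantelli: the bounds (s / t)^n are summable. *)
Lemma slow_return_eventually_low r s t o : 0 < r < s -> s < t ->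
  {ae P, forall w, slow r (E w) o ->
    exists N, forall n, (N <= n)%N -> ret n (E w) o < t ^+ n}.
Proof.
move=> rs st; have /andP[r0 rs'] := rs; have t0 : 0 < t by lra.
(* Times are shifted by one because the estimate needs n > 0. *)
pose F n := [set w | slow r (E w) o /\ (t ^+ n.+1 <= ret n.+1 (E w) o)].
have mF n : measurable (F n).
  rewrite (_ : F n = E @^-1` ([set c | slow r c o] `&`
    (setT `&` [set c | t ^+ n.+1 <= ret n.+1 c o]))); last by rewrite setTI.
  rewrite -[X in measurable X]setTI; apply: mE => //.
  apply: measurableI; first exact: measurable_slow_return.
  by apply: measurable_fun_le => //; exact: measurable_return_prob.
have q1 : `|s / t| < 1.
  by rewrite ger0_norm ?divr_ge0 ?ltW// ?ltr_pdivrMr ?mul1r//; lra.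
have sumF : (\big[+%E/0%R]_(0 <= n <oo) P (F n) < +oo)%E.
  apply: (@le_lt_trans _ _ (\big[+%E/0%R]_(0 <= n <oo) (geometric 1 (s / t) n)%:E)%E).
    apply: lee_nneseries => [n _ _|n _]; first exact: measure_ge0.
    apply: le_trans (slow_return_rarely_high _ _ rs t0) _ => //.
    rewrite lee_fin /geometric/= mul1r exprS ler_piMl//.
      by rewrite exprn_ge0// divr_ge0// ltW//; lra.
    by apply: ltW; apply: le_lt_trans q1; exact: ler_norm.
  rewrite (_ : (fun n => _) = EFin \o series (geometric 1 (s / t))); last first.
    by apply/funext => n; rewrite /= seriesEnat sumEFin.
  by rewrite EFin_lim ?ltry//; exact: is_cvg_geometric_series.
exists (lim_sup_set F); split.
- apply: bigcap_measurable => // n _; exact: bigcup_measurable.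
- exact: lim_sup_set_cvg0.
move=> w /= bad N _; apply: contrapT => noj; apply: bad => sw.
exists N.+1 => -[//|n] Nn; rewrite real_ltNge ?num_real//; apply/negP => h.
by apply: noj; exists n.
Qed.

End InvariantPercolation.

(** * The law of the lazy walk *)

Section LazyWalk.
Variables (V : choiceType) (adj : rel V) (d : nat) (nb : V -> seq V).
Hypothesis d_gt0 : (0 < d)%N.
Hypothesis adj_irr : irreflexive adj.
Hypothesis uniq_nb : forall x, uniq (nb x).
Hypothesis size_nb : forall x, size (nb x) = d.
Hypothesis mem_nb : forall x y, (y \in nb x) = adj x y.
Variables (R : realType) (dsp : measure_display) (T : measurableType dsp).
Variables (P : probability T R) (o : V) (X : nat -> T -> V).
Hypothesis XP : lazy_random_walk adj P d o X.

Local Notation pr A := (fine (P A)).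

Let mX n S : measurable (X n @^-1` S) := lazy_walk_measurable XP n S.

Lemma sum_lazy_step (g : V -> R) x :
  \sum_(y <- x :: nb x) lazy_step adj R d x y * g y =
  (\sum_(y <- moves d nb x) g y) / (2 * d%:R).
Proof.
rewrite big_cons sum_moves /lazy_step eqxx [RHS]mulrDl; congr (_ + _).
  by field; rewrite pnatr_eq0 -lt0n.
rewrite mulr_suml; apply: eq_big_seq => y; rewrite mem_nb => xy.
rewrite xy; case: eqP => [xy'|_]; first by rewrite -xy' adj_irr in xy.
by rewrite div1r mulrC.
Qed.

Lemma probability_partition (Y : T -> V) (A : set T) (L : seq V) :
  (forall S, measurable (Y @^-1` S)) -> measurable A -> uniq L ->
  pr A = \sum_(y <- L) pr (A `&` Y @^-1` [set y]) +
         pr (A `&` Y @^-1` [set y | y \notin L]).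
Proof.
move=> mY mA; elim: L => [|z L IH] /=.
  move=> _; rewrite big_nil add0r; congr (fine (P _)).
  by apply/seteqP; split=> [w Aw|w []//]; split.
move=> /andP[zL uL]; rewrite IH// big_cons.
suff -> : pr (A `&` Y @^-1` [set y | y \notin L]) = pr (A `&` Y @^-1` [set z]) +
    pr (A `&` Y @^-1` [set y | y \notin z :: L]) by ring.
rewrite -fineD ?fin_num_measure//; try exact: measurableI.
rewrite -measureU//; try exact: measurableI.
  congr (fine (P _)); apply/seteqP; split=> w.
    move=> [Aw /= Yw]; have [Yz|Yz] := eqVneq (Y w) z; first by left.
    by right; split=> //=; rewrite inE negb_or Yz.
  move=> [[Aw /= ->]|[Aw /=]]; first by [].
  by rewrite inE negb_or => /andP[_ ?].
by apply/seteqP; split=> // w [[_ /= Yz] [_ /=]]; rewrite Yz inE eqxx.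
Qed.

Definition history n (h : nat -> V) : set T :=
  [set w | forall i, (i <= n)%N -> X i w = h i].

Lemma measurable_history n h : measurable (history n h).
Proof.
have -> : history n h = \bigcap_(i in [set i | (i <= n)%N]) X i @^-1` [set h i].
  by apply/seteqP; split=> w hw i /=; exact: hw.
by apply: bigcap_measurable => [|i _]; [exists 0%N|exact: mX].
Qed.

Definition extend_history n (h : nat -> V) y i := if (i <= n)%N then h i else y.

Lemma history_extend n h y :
  history n.+1 (extend_history n h y) = history n h `&` X n.+1 @^-1` [set y].
Proof.
apply/seteqP; split=> [w hw|w [hw Xw] i].
  split=> [i ni|/=]; first by rewrite hw ?leqW// /extend_history ni.
  by rewrite hw// /extend_history ltnn.
by rewrite leq_eqVlt ltnS /extend_history => /predU1P[->|ni];
  rewrite ?ltnn ?ni//; exact: hw.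
Qed.

Lemma probability_history_extend n h y :
  pr (history n h `&` X n.+1 @^-1` [set y]) =
  pr (history n h) * lazy_step adj R d (h n) y.
Proof.
rewrite -history_extend; have := lazy_walk_step XP (extend_history n h y) n.
rewrite -/(history _ _) -/(history _ _).
have -> : history n (extend_history n h y) = history n h.
  by apply/seteqP; split=> w hw i ni; have := hw i ni;
    rewrite /extend_history ni.
move=> ->; rewrite fineM ?fin_num_measure//; last exact: measurable_history.
by rewrite /extend_history leqnn ltnn.
Qed.

(** Induction on the remaining time m, conditioning on the next position.  The
possible next positions form a finite list L, and the transition probabilities
over L sum to 1, so the event of leaving L is null. *)
Lemma walk_law_after_history m n h S :
  pr (history n h `&` X (n + m) @^-1` S) =
  pr (history n h) * walk_mean d nb m (fun y => `[< S y >]%:R) (h n).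
Proof.
elim: m n h => [|m IH] n h.
  rewrite addn0 walk_mean0; have [Sh|nSh] := pselect (S (h n)).
    rewrite asboolT// mulr1; congr (fine (P _)).
    by apply/seteqP; split=> [w []//|w hw]; split=> //=; rewrite hw.
  rewrite asboolF// mulr0 (_ : _ `&` _ = set0) ?measure0//.
  by apply/seteqP; split=> // w [hw /=]; rewrite hw.
set L := h n :: nb (h n).
have uL : uniq L by rewrite /= uniq_nb mem_nb adj_irr.
have mH := measurable_history n h.
have null : pr (history n h `&` X n.+1 @^-1` [set y | y \notin L]) = 0.
  have := probability_partition (mX n.+1) mH uL.
  under eq_bigr do rewrite probability_history_extend.
  rewrite -mulr_sumr.
  have -> : \sum_(y <- L) lazy_step adj R d (h n) y = 1.
    under eq_bigr do rewrite -[lazy_step _ _ _ _ _]mulr1.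
    rewrite sum_lazy_step -[RHS](walk_mean_cst d_gt0 size_nb 1 1 (h n)) walk_meanS.
    by congr (_ / _); apply: eq_bigr => y _; rewrite walk_mean0.
  by rewrite mulr1 => /esym/(canRL (addKr _)); rewrite addrC subrr.
have mA : measurable (history n h `&` X (n + m.+1) @^-1` S) by exact: measurableI.
rewrite (probability_partition (mX n.+1) mA uL).
rewrite [X in _ + X](_ : _ = 0) ?addr0; last first.
  apply/le_anti/andP; split; last by rewrite fine_ge0// measure_ge0.
  have mN := mX n.+1 [set y | y \notin L].
  have mAN := measurableI _ _ mA mN; have mHN := measurableI _ _ mH mN.
  rewrite -null fine_le ?fin_num_measure//.
  by apply: le_measure; rewrite ?in_setE// => w [[hw _] ?].
transitivity (\sum_(y <- L) pr (history n h) * (lazy_step adj R d (h n) y *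
    walk_mean d nb m (fun y => `[< S y >]%:R) y)).
  apply: eq_bigr => y _.
  rewrite mulrA -probability_history_extend -history_extend setIAC -history_extend.
  by rewrite addnS -addSn IH /extend_history ltnn.
by rewrite -mulr_sumr sum_lazy_step walk_meanS.
Qed.

Lemma walk_law n S :
  pr (X n @^-1` S) = walk_mean d nb n (fun y => `[< S y >]%:R) o.
Proof.
have := walk_law_after_history n 0 (fun=> o) S.
have h0 : history 0 (fun=> o) = [set w | X 0%N w = o].
  by apply/seteqP; split=> [w hw|w Xw i]; [exact: hw|rewrite leqn0 => /eqP->].
rewrite h0 (lazy_walk_start XP) mul1r add0n => <-.
have mo : measurable [set w | X 0%N w = o] by exact: (mX 0%N [set o]).
congr fine; rewrite setIC; apply/esym/eqP.
have Pc : P (~` [set w | X 0%N w = o]) = 0%E.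
  by rewrite probability_setC// (lazy_walk_start XP) subee.
rewrite eq_le; apply/andP; split.
  by apply: le_measure; rewrite ?in_setE//; exact: measurableI.
rewrite -[leRHS]adde0 -Pc; apply: le_trans (measureU2 _ _ _);
  rewrite ?in_setE//.
- apply: le_measure; rewrite ?in_setE//; first by
    apply: measurableU; [exact: measurableI|exact: measurableC].
  move=> w Sw; have [Xw|Xw] := pselect (X 0%N w = o); [by left|by right].
- exact: measurableI.
- exact: measurableC.
Qed.

End LazyWalk.

(** * Convergence of the roots *)

Section Roots.
Variable R : realType.

(** Let rho be the lower limit of p_n^(1/n).  For rationals rho < r < s the
hypothesis applies to r, so the roots are eventually below s. *)
Lemma cvg_root (p : nat -> R) : (forall n, 0 < p n <= 1) ->
  (forall r s : rat, 0 < (ratr r : R) -> ratr r < ratr s :> R ->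
    (forall N, exists2 m, (N <= m)%N & p m <= ratr r ^+ m) ->
    exists N, forall n, (N <= n)%N -> p n < ratr s ^+ n) ->
  exists rho : R, (fun n => p n `^ (n%:R^-1)) @ \oo --> rho.
Proof.
move=> p01 gap; pose u n := p n `^ (n%:R^-1).
have u0 n : 0 <= u n by exact: powR_ge0.
have uX n : (0 < n)%N -> u n ^+ n = p n.
  move=> n0; have /andP[p0 _] := p01 n; rewrite -powR_mulrn// -powRrM.
  by rewrite mulVf ?powRr1 ?ltW// pnatr_eq0 -lt0n.
have u_lt n x : (0 < n)%N -> 0 <= x -> (u n < x) = (p n < x ^+ n).
  by move=> n0 x0; rewrite -(uX n n0) ltr_pXn2r ?nnegrE.
have u_le1 n : (0 < n)%N -> u n <= 1.
  by move=> n0; rewrite -(ler_pXn2r n0) ?nnegrE// expr1n uX//;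
    have /andP[] := p01 n.
(* The supremum of S is the lower limit of u. *)
pose S := [set x | exists N, forall n, (N <= n)%N -> x <= u n].
have S0 : S 0 by exists 0%N.
have supS : has_sup S.
  split; first by exists 0.
  by exists 1 => x [N hN]; apply: le_trans (hN (maxn N 1) _) (u_le1 _ _);
    rewrite leq_max leqnn ?orbT.
exists (sup S); apply/cvgrPdist_lt => e e0.
have [x [N hN] xe] := sup_adherent e0 supS.
have rho0 : 0 <= sup S by exact: (ub_le_sup supS.2).
have [r /andP[rho_r r_e]] : exists r : rat, sup S < ratr r < sup S + e.
  have /rat_in_itvoo[r] : sup S < sup S + e by rewrite ltrDl.
  by rewrite in_itv; exists r.
have [s /andP[r_s s_e]] : exists s : rat, (ratr r : R) < ratr s < sup S + e.
  by have [s] := rat_in_itvoo r_e; rewrite in_itv; exists s.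
have r0 : 0 < (ratr r : R) by exact: le_lt_trans rho_r.
have [N' hN'] : exists N, forall n, (N <= n)%N -> p n < ratr s ^+ n.
  apply: (gap r s r0 r_s) => M; apply: contrapT => noM.
  have : S (ratr r).
    exists (maxn M 1) => n; rewrite geq_max => /andP[Mn n0].
    rewrite leNgt u_lt ?ltW//; apply/negP => pn; apply: noM; exists n => //;
      exact: ltW.
  by move=> /(ub_le_sup supS.2); rewrite leNgt rho_r.
exists (maxn (maxn N N') 1) => // n /=;
  rewrite !geq_max => /andP[/andP[Nn N'n] n0].
rewrite ltr_distl; apply/andP; split.
  have us : u n < ratr s by rewrite u_lt// ?hN'// ltW// (lt_trans r0).
  by rewrite ltrBlDr; exact: lt_trans us s_e.
by rewrite -ltrBlDr; exact: lt_le_trans xe (hN n Nn).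
Qed.

End Roots.

Theorem theorem2 (d : nat) (V : choiceType) (adj : rel V) (o : V)
    (R : realType) (dsp : measure_display) (T : measurableType dsp)
    (P : probability T R)
    (E : T -> configuration adj) (X : nat -> T -> V) :
  (0 < d)%N ->
  is_regular_tree adj d ->
  invariant_percolation P E ->
  lazy_random_walk adj P d o X ->
  independent_of_walk P E X ->
  {ae P, forall w, exists rho : R,
    (fun n : nat => cluster_hit_probability P X o (E w) n `^ (n%:R^-1)) @ \oo
      --> rho}.
Proof.
move=> d0 tree EP XP _.
have [nb nbP] := regular_neighbours tree.
have uniq_nb x : uniq (nb x) by have [] := nbP x.
have size_nb x : size (nb x) = d by have [] := nbP x.
have mem_nb x y : (y \in nb x) = adj x y by have [_ _ ->] := nbP x.
have hitE w n : cluster_hit_probability P X o (E w) n = return_prob R adj d nb n (E w) o.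
  rewrite /cluster_hit_probability.
  rewrite (walk_law d0 (tree_irreflexive tree) uniq_nb size_nb mem_nb XP n
    (cluster (E w) o)).
  congr walk_mean; apply/funext => y; congr (nat_of_bool _)%:R.
  have cl := cluster_linked (tree_symmetric tree) o y (percolation_edges EP (w := w)).
  by apply/asboolP/idP => /cl.
(* The pairs of rationals are enumerated because almost sure statements pass to
   countable conjunctions. *)
have gap (k : nat) : \forall w \ae P, forall rs : rat * rat,
    choice.unpickle k = Some rs ->
    0 < (ratr rs.1 : R) -> ratr rs.1 < ratr rs.2 :> R ->
    slow_return adj d nb (ratr rs.1 : R) (E w) o ->
    exists N, forall n, (N <= n)%N ->
      return_prob R adj d nb n (E w) o < ratr rs.2 ^+ n.
  case: (choice.unpickle k) => [[r s]|]; last by apply: aeW.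
  have [rs|/negP nrs] := boolP (0 < (ratr r : R) < ratr s); last first.
    by apply: aeW => w _ [<-] /= r0 rs; case: nrs; rewrite r0.
  have [r0 rs'] := andP rs.
  pose m : R := (ratr r + ratr s) / 2.
  have rm : 0 < (ratr r : R) < m by rewrite r0 /m midf_lt.
  have ms : m < ratr s by rewrite /m midf_lt.
  have := slow_return_eventually_low d0 tree uniq_nb size_nb mem_nb EP o rm ms.
  by apply: filterS => w h _ [<-].
have := ae_foralln gap; apply: filterS => w {}gap.
rewrite (_ : (fun n => _) =
    fun n => return_prob R adj d nb n (E w) o `^ n%:R^-1); last first.
  by apply/funext => n; rewrite hitE.
apply: cvg_root => [n|r s r0 rs io].
  by rewrite return_prob_gt0//= return_prob_le1.
apply: (gap (choice.pickle (r, s)) (r, s) _ r0 rs);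
  first by rewrite choice.pickleK.
by exists 1%N => N; have [m Nm hm] := io N; exists m => //; rewrite mul1r.
Qed.
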